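(* Let $n\ge 1$ be an integer, let $\gamma_n=\frac{n!}{n^n}$, and let $A\in K_n$ and $\delta\in\mathbb{R}$ satisfy $$\Phi(A)\ge 2-\gamma_n,\qquad \operatorname{per}(A)=\gamma_n-\delta,\qquad 0\le\delta<1.$$ Set $$t=\sqrt{\frac{n\delta}{1-\delta}}.$$ If $t<1$, then the matrix $(1-t)^{-1}A$ is doubly superstochastic.
   Context: $K_n$ is the set of real $n\times n$ matrices $A=(a_{ij})$ with nonnegative entries satisfying $\sum_{i,j=1}^n a_{ij}=n$. For $A\in K_n$ the row and column sums are $r_i=\sum_{j=1}^n a_{ij}$ and $c_j=\sum_{i=1}^n a_{ij}$, and the Dittert functional is $$\Phi(A)=\prod_{i=1}^n r_i+\prod_{j=1}^n c_j-\operatorname{per}(A),$$ where $\operatorname{per}(A)=\sum_{\pi\in S_n}\prod_{i=1}^n a_{i\pi(i)}$ is the permanent. A matrix is doubly stochastic if its entries are nonnegative and all its row sums and column sums equal $1$. A nonnegative $n\times n$ matrix $S$ is doubly superstochastic if there exists a doubly stochastic $n\times n$ matrix $B$ such that $B\le S$ entrywise. *)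

(* Defs.v *)
From HB Require Import structures.
From mathcomp Require Import all_boot all_order all_algebra all_fingroup.
From mathcomp Require Import reals.

Set Implicit Arguments.
Unset Strict Implicit.
Unset Printing Implicit Defensive.

Import Order.TTheory GRing.Theory Num.Theory.
Local Open Scope ring_scope.

Section Dittert.
Variables (R : realType) (n : nat).
Implicit Types A B S : 'M[R]_n.

Definition nonneg_mx A : Prop := forall i j, 0 <= A i j.

Definition rsum A (i : 'I_n) : R := \sum_j A i j.
Definition csum A (j : 'I_n) : R := \sum_i A i j.

Definition inK A : Prop := nonneg_mx A /\ \sum_i \sum_j A i j = n%:R.

Definition permanent A : R := \sum_(s : 'S_n) \prod_i A i (s i).

Definition dittert A : R :=
  \prod_i rsum A i + \prod_j csum A j - permanent A.

Definition doubly_stochastic B : Prop :=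
  [/\ nonneg_mx B, forall i, rsum B i = 1 & forall j, csum B j = 1].

Definition doubly_superstochastic S : Prop :=
  nonneg_mx S /\
  exists B, doubly_stochastic B /\ forall i j, B i j <= S i j.

End Dittert.

Definition gamma (R : realType) (n : nat) : R := n`!%:R / n%:R ^+ n.

(* Main.v *)
Require Import Defs.
From HB Require Import structures.
From mathcomp Require Import all_boot all_order all_algebra all_fingroup.
From mathcomp Require Import reals.
From mathcomp Require Import ring lra.
From mathcomp.real_closed Require Import polyrcf.

Import Order.TTheory GRing.Theory Num.Theory.
Local Open Scope ring_scope.

(** Why the theorem holds.  The two hypotheses on Phi and per say that the
    product p of the row sums and the product q of the column sums satisfy
    p + q >= 2 - delta.  Both are at most 1 by AM-GM, because the sums average
    to 1, hence p * q >= p + q - 1 >= 1 - delta.  So the 2n row and column sums,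
    taken together, have mean 1 and a product close to 1, and this forces every
    partial total of them to be close to its expected value: if D is the
    deficit of some of these sums, i.e. the sum of 1 - z over them, then
    p * q * (1 + D^2 / n) <= 1 ([prod_le_deficit]), which gives D <= t.
    [prod_le_deficit] is the Pinsker inequality
    -ln (p * q) >= D^2 / n, with exp (D^2 / n) replaced by the smaller
    1 + D^2 / n.  Treating rows and columns as one family of size 2n, and not
    bounding their deficits separately, is what yields the constant in t.

    A nonnegative S dominates a doubly stochastic matrix as soon as
    S(I x J) >= |I| + |J| - n for all sets I of rows and J of columns
    ([superstochastic_of_slack]), a condition known from transportation
    problems.  For A, discarding the complementary rectangle gives
    A(I x J) >= |I| + |J| - n - D with D the deficit of the rows in I and the
    columns in J.  When s = |I| + |J| - n is positive it is an
    integer, so s - D >= s - t >= (1 - t) * s, which is the condition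
    for A / (1 - t); when s <= 0 there is nothing to prove. *)

(** * Products of nonnegative numbers of mean one *)

(** Extremal case of the deficit bound: m numbers lowered by x / m and l numbers
    raised by x / l.  The left side is 1 at x = 0, and for 0 < x < m
    its derivative has the sign of
    -[(m + l)^2 - 4 (m - x) (l + x) + 2 (m + l) x^2]; this is nonpositive since
    m + l is the sum of m - x and l + x, so that its square is at least four
    times their product.  The left side is a polynomial in x, so the mean value
    theorem for polynomials over a real closed field is enough. *)
Lemma two_level_prod_le (R : rcfType) (m l : nat) (x : R) :
  (0 < m)%N -> (0 < l)%N -> 0 <= x <= m%:R ->
  (1 - x / m%:R) ^+ m * (1 + x / l%:R) ^+ l * (1 + 2 * x ^+ 2 / (m + l)%:R) <= 1.
Proof.
case: m l => [//|m] [//|l] _ _ /andP[x_ge0 x_le].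
set a : R := m.+1%:R in x_le *; set b : R := l.+1%:R.
have a_gt0 : 0 < a by rewrite ltr0n.
have b_gt0 : 0 < b by rewrite ltr0n.
rewrite natrD -/a -/b.
pose p : {poly R} := (1 - a^-1 *: 'X) ^+ m.+1 * (1 + b^-1 *: 'X) ^+ l.+1
                     * (1 + (2 / (a + b)) *: 'X^2).
have pE y : p.[y] = (1 - y / a) ^+ m.+1 * (1 + y / b) ^+ l.+1
                     * (1 + 2 * y ^+ 2 / (a + b)).
  rewrite /p !(hornerM, hornerD, hornerN, horner_exp, hornerZ, hornerX,
             hornerC, hornerXn).
  by congr (_ ^+ _ * _ ^+ _ * _); ring.
rewrite -pE; have p0 : p.[0] = 1.
  by rewrite pE !mul0r expr0n mulr0 mul0r subr0 !addr0 !expr1n !mulr1.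
move: x_ge0; rewrite le_eqVlt => /predU1P[<-|x_gt0]; first by rewrite p0.
have [c /[!in_itv]/= /andP[c_gt0 c_lt]] := poly_mvt p x_gt0.
rewrite p0 subr0 => dp; rewrite -subr_le0 dp pmulr_lle0 //.
(* The two powers are nonnegative, so the bracket decides the sign. *)
have dpE : p^`().[c] = (1 - c / a) ^+ m * (1 + c / b) ^+ l *
   (- ((1 + c / b) - (1 - c / a)) * (1 + 2 * c ^+ 2 / (a + b))
    + (1 - c / a) * (1 + c / b) * (4 * c / (a + b))).
  rewrite /p !derivM !deriv_exp !derivD !derivN !derivZ derivX derivXn !derivC.
  rewrite !(hornerM, hornerD, hornerN, hornerMn, horner_exp, hornerZ, hornerX,
            hornerC, hornerXn).
  rewrite -[_ *+ m.+1]mulr_natr -[_ *+ l.+1]mulr_natr -/a -/b /=; clearbody a b.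
  rewrite !(exprS _ m) !(exprS _ l) !(mulrC _^-1 c).
  move: (_ ^+ m) (_ ^+ l) => U V.
  by field; rewrite !gt_eqF ?addr_gt0.
clearbody a b; have u_ge0 : 0 <= 1 - c / a.
  by rewrite subr_ge0 ler_pdivrMr // mul1r ltW // (lt_le_trans c_lt).
have v_ge0 : 0 <= 1 + c / b by rewrite addr_ge0 // divr_ge0 // ltW.
rewrite dpE mulr_ge0_le0 ?mulr_ge0 ?exprn_ge0 //.
have -> : - ((1 + c / b) - (1 - c / a)) * (1 + 2 * c ^+ 2 / (a + b))
    + (1 - c / a) * (1 + c / b) * (4 * c / (a + b)) =
   - (c / (a * b * (a + b)) * ((a + b - 2 * (a - c)) ^+ 2
        + (a + b) * (2 * c ^+ 2))).
  by field; rewrite !gt_eqF ?addr_gt0.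
have ab_ge0 : 0 <= a + b by rewrite ltW ?addr_gt0.
rewrite oppr_le0; apply: mulr_ge0.
  by rewrite divr_ge0 // ?mulr_ge0 // ltW.
by rewrite addr_ge0 ?sqr_ge0 // mulr_ge0 // mulr_ge0 // sqr_ge0.
Qed.

(** Replacing the numbers indexed by A, and those outside A, by their respective
    means keeps all totals and can only increase the product (AM-GM), which
    reduces the bound to two levels.  The deficit may be assumed nonnegative,
    since A and its complement have opposite deficits. *)
Lemma prod_le_deficit {R : rcfType} {T : finType} {z : T -> R} (A : {set T}) :
  (forall k, 0 <= z k) -> \sum_k z k = #|T|%:R ->
  \prod_k z k * (1 + 2 * (\sum_(k in A) (1 - z k)) ^+ 2 / #|T|%:R) <= 1.
Proof.
move=> z_ge0 sumz.
have setCE (B : {set T}) k : (k \in ~: B) = (k \notin B) by rewrite inE.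
have defC (B : {set T}) : \sum_(k in ~: B) (1 - z k) = - \sum_(k in B) (1 - z k).
  apply/eqP; rewrite -addr_eq0 addrC (eq_bigl _ _ (setCE B)) -(bigID (mem B) predT) /=.
  by rewrite sumrB sumz sumr_const subrr.
wlog x_ge0 : A / 0 <= \sum_(k in A) (1 - z k).
  move=> hw; have [/hw//|x_lt0] := leP 0 (\sum_(k in A) (1 - z k)).
  by have := hw (~: A); rewrite defC sqrrN; apply; rewrite oppr_ge0 ltW.
set x := \sum_(k in A) _ in x_ge0 *.
have AGM (B : {set T}) :
    \prod_(k in B) z k <= (1 - (\sum_(k in B) (1 - z k)) / #|B|%:R) ^+ #|B|.
  have [B0|B_gt0] := posnP #|B|.
    by rewrite B0 expr0 big1 // => k; rewrite (card0_eq B0).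
  have [+ _] := @leif_AGM R T (mem B) z (fun k _ => z_ge0 k).
  by rewrite sumrB sumr_const mulrBl divff ?pnatr_eq0 -?lt0n // opprB addrC subrK.
have prod_le1 : \prod_k z k <= 1.
  have := AGM setT; rewrite -setC0 defC big_set0 oppr0 mul0r subr0 expr1n.
  by rewrite (eq_bigl _ _ (setCE _)); under eq_bigl do rewrite inE.
have prod_ge0 (B : {set T}) : 0 <= \prod_(k in B) z k by rewrite prodr_ge0.
have [A0|A_gt0] := posnP #|A|.
  have -> : x = 0 by rewrite /x (cards0_eq A0) big_set0.
  by rewrite expr0n mulr0 mul0r addr0 mulr1.
have [C0|C_gt0] := posnP #|~: A|.
  have -> : x = 0 by apply/eqP; rewrite -oppr_eq0 -defC (cards0_eq C0) big_set0.
  by rewrite expr0n mulr0 mul0r addr0 mulr1.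
have x_le : x <= #|A|%:R.
  by rewrite /x sumrB sumr_const gerBl sumr_ge0.
have := @two_level_prod_le R _ _ x A_gt0 C_gt0; rewrite x_ge0 x_le cardsC => /(_ isT).
apply: le_trans; apply: ler_wpM2r.
  by rewrite addr_ge0 // divr_ge0 // mulr_ge0 // sqr_ge0.
rewrite (bigID (mem A)) /= -(eq_bigl _ _ (setCE A)).
apply: ler_pM => //.
by have := AGM (~: A); rewrite defC mulNr opprK.
Qed.

(** * Dominating a doubly stochastic matrix *)

(** A matrix dominating a doubly stochastic B has nonnegative slacks: the rows
    in I carry total mass |I| in B, of which at most n - |J| lies outside the
    columns in J. *)
Definition slack {R : realDomainType} {n} (S : 'M[R]_n) (I J : {set 'I_n}) : R :=
  \sum_(i in I) \sum_(j in J) S i j - (#|I|%:R + #|J|%:R - n%:R).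

(** The entries that can be decreased a little without making any entry or
    slack negative, provided none of them is to begin with. *)
Definition loose {R : realDomainType} {n} (S : 'M[R]_n) (i j : 'I_n) : bool :=
  (S i j != 0)
  && [forall I : {set 'I_n}, forall J : {set 'I_n},
        (i \in I) && (j \in J) ==> (slack S I J != 0)].

Lemma slack_tr (R : realDomainType) n (S : 'M[R]_n) I J :
  slack S^T I J = slack S J I.
Proof.
rewrite /slack exchange_big /= [#|I|%:R + _]addrC; congr (_ - _).
by apply: eq_bigr => j _; apply: eq_bigr => i _; rewrite mxE.
Qed.

Lemma loose_tr (R : realDomainType) n (S : 'M[R]_n) i j :
  loose S^T i j = loose S j i.
Proof.
rewrite /loose mxE; congr (_ && _).
apply/'forall_forallP/'forall_forallP => h I J; have := h J I;
  by rewrite slack_tr andbC.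
Qed.

Lemma slack_sub_delta (R : realDomainType) n (S : 'M[R]_n) (e : R) i0 j0 I J :
  slack (S - e *: delta_mx i0 j0) I J
    = slack S I J - e *+ ((i0 \in I) && (j0 \in J)).
Proof.
rewrite /slack [RHS]addrAC; congr (_ - _).
have -> : e *+ ((i0 \in I) && (j0 \in J))
    = \sum_(i in I) \sum_(j in J) (e *: delta_mx i0 j0 : 'M_n) i j.
  under eq_bigr => i _ do under eq_bigr => j _ do
    rewrite !mxE -mulnb natrM mulrA [e * _]mulrC -mulrA.
  rewrite big_mkcond (bigD1 i0) //= eqxx [X in _ + X]big1 => [|i /negPf->]; last first.
    by case: ifP => // _; rewrite big1 // => j _; rewrite mul0r.
  case: (i0 \in I); last by rewrite addr0.
  rewrite addr0 big_mkcond (bigD1 j0) //= eqxx [X in _ + X]big1 => [|j /negPf->]; last first.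
    by rewrite !mulr0 if_same.
  by case: (j0 \in J); rewrite !addr0 // mulr1 mul1r.
rewrite -sumrB; apply: eq_bigr => i _; rewrite -sumrB.
by apply: eq_bigr => j _; rewrite !mxE.
Qed.

(** Uncrossing: an entry covered by one of the two rectangles on the left is
    covered at least as often on the right, while the cardinals balance.  Hence
    rectangles of slack zero are stable under this crossing. *)
Lemma slack_cross {R : realDomainType} {n} {S : 'M[R]_n} (I I' J J' : {set 'I_n}) :
  (forall i j, 0 <= S i j) ->
  slack S (I :&: I') (J :|: J') + slack S (I :|: I') (J :&: J')
    <= slack S I J + slack S I' J'.
Proof.
move=> S_ge0.
have rectE (K L : {set 'I_n}) : \sum_(i in K) \sum_(j in L) S i j =
    \sum_i \sum_j S i j *+ ((i \in K) && (j \in L)).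
  rewrite big_mkcond; apply: eq_bigr => i _ /=; case: (i \in K); last first.
    by rewrite big1.
  by rewrite big_mkcond; apply: eq_bigr => j _ /=; case: (j \in L).
have cI := congr1 (fun k => k%:R : R) (cardsUI I I').
have cJ := congr1 (fun k => k%:R : R) (cardsUI J J').
rewrite /= !natrD in cI cJ.
rewrite /slack addrACA [leRHS]addrACA.
have -> : forall a b c d e : R,
   - (a + b - e) - (c + d - e) = - (c + a) - (b + d) + e + e by move=> *; ring.
rewrite cI cJ.
have -> : forall a b c d e : R,
   - (a + b - e) - (c + d - e) = - (a + c) - (b + d) + e + e by move=> *; ring.
rewrite lerD2r !rectE -!big_split /=.
apply: ler_sum => i _; rewrite -!big_split; apply: ler_sum => j _ /=.
rewrite -!mulrnDr; apply: ler_wpMn2l => //; rewrite !inE.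
by case: (i \in I); case: (i \in I'); case: (j \in J); case: (j \in J').
Qed.

(** In a matrix that cannot be decreased, crossing the zero-slack rectangles
    through the nonzero entries of row i0 gives one zero-slack rectangle
    I x J with i0 in I and J containing the support of that row.  Removing i0
    from I lowers the slack by the row sum minus 1, so the row sum is
    at most 1; the rectangle of the single row i0 shows that it is at least 1. *)
Lemma rsum_tight (R : realDomainType) n (S : 'M[R]_n) :
  (forall i j, 0 <= S i j) -> (forall I J, 0 <= slack S I J) ->
  (forall i j, ~~ loose S i j) -> forall i, \sum_j S i j = 1.
Proof.
move=> S_ge0 slack_ge0 tight i0.
have [I [J [i0I IJ0 supJ]]] : exists I J : {set 'I_n}, [/\ i0 \in I, slack S I J = 0 &
    forall j, S i0 j != 0 -> j \in J].
  suff [I [J [i0I IJ0 supJ]]] : exists I J : {set 'I_n}, [/\ i0 \in I, slack S I J = 0 &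
      forall j, j \in enum 'I_n -> S i0 j != 0 -> j \in J].
    by exists I, J; split=> // j; apply: supJ; rewrite mem_enum.
  elim: (enum 'I_n) => [|j s [I [J [i0I IJ0 supJ]]]].
    (* A rectangle with all rows and no column has slack zero. *)
    exists setT, set0; split; rewrite ?inE // /slack.
    rewrite big1 => [|i _]; last by rewrite big_set0.
    by rewrite cardsT card_ord cards0 addr0 !subrr.
  have [Sj0|Sj_neq0] := eqVneq (S i0 j) 0.
    exists I, J; split=> // k; rewrite inE => /predU1P[->|/supJ//].
    by rewrite Sj0 eqxx.
  have := tight i0 j; rewrite /loose Sj_neq0 => /forallPn[I' /forallPn[J']].
  rewrite negb_imply negbK => /andP[/andP[i0I' jJ'] /eqP IJ0'].
  exists (I :&: I'), (J :|: J'); split; first by rewrite inE i0I.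
    apply/eqP; rewrite eq_le slack_ge0 andbT.
    have := slack_cross I I' J J' S_ge0; rewrite IJ0 IJ0' addr0.
    by apply: le_trans; rewrite lerDl.
  move=> k; rewrite !inE => /predU1P[->|ks] Sk; first by rewrite jJ' orbT.
  by rewrite (supJ k).
apply/eqP; rewrite eq_le; apply/andP; split; last first.
  have := slack_ge0 [set i0] setT.
  rewrite /slack big_set1 cards1 cardsT card_ord addrK subr_ge0.
  by under eq_bigl do rewrite inE.
have -> : \sum_j S i0 j = \sum_(j in J) S i0 j.
  rewrite [RHS]big_mkcond; apply: eq_bigr => j _.
  by case: ifPn => // /(contraNeq (supJ j)).
have := slack_ge0 (I :\ i0) J; move/eqP: IJ0; rewrite /slack subr_eq0.
rewrite (big_setD1 i0) //= (cardsD1 i0 I) i0I add1n -nat1r => /eqP.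
by lra.
Qed.

(** Sufficiency of the rectangle condition.  Decrease a loose entry until it
    vanishes or the smallest slack of a rectangle through it does.  Slacks stay
    nonnegative and can only decrease, so no other entry becomes loose and the
    number of loose entries drops.  When none is left, rows and
    (by transposition) columns sum to 1. *)
Theorem superstochastic_of_slack {R : realDomainType} {n} {S : 'M[R]_n} :
  (forall i j, 0 <= S i j) -> (forall I J, 0 <= slack S I J) ->
  exists B : 'M[R]_n, [/\ forall i j, 0 <= B i j, forall i, \sum_j B i j = 1,
    forall j, \sum_i B i j = 1 & forall i j, B i j <= S i j].
Proof.
pose L (S : 'M[R]_n) := [set ij | loose S ij.1 ij.2].
have [k] := ubnP #|L S|; elim: k S => // k IHk S; rewrite ltnS => leLk.
move=> S_ge0 slack_ge0; have [L0|[[i0 j0]]] := set_0Vmem (L S).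
  have tight i j : ~~ loose S i j.
    by apply/negP => lij; have := in_set0 (i, j); rewrite -L0 inE lij.
  exists S; split=> //; first exact: rsum_tight.
  move=> j; rewrite -(@rsum_tight _ _ S^T _ _ _ j).
  - by apply: eq_bigr => i _; rewrite mxE.
  - by move=> i i'; rewrite mxE.
  - by move=> I J; rewrite slack_tr.
  - by move=> i i'; rewrite loose_tr.
rewrite inE /= => loose_ij.
pose P (IJ : {set 'I_n} * {set 'I_n}) := (i0 \in IJ.1) && (j0 \in IJ.2).
have PT : P (setT, setT) by rewrite /P !inE.
have [[I J] PIJ minIJ] := Order.TotalTheory.arg_minP (fun IJ => slack S IJ.1 IJ.2) PT.
set e := Num.min (S i0 j0) (slack S I J).
have e_ge0 : 0 <= e by rewrite le_min S_ge0 slack_ge0.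
pose S' := S - e *: delta_mx i0 j0.
have S'E i j : S' i j = S i j - e *+ ((i == i0) && (j == j0)).
  by rewrite !mxE mulr_natr.
have S'_le i j : S' i j <= S i j by rewrite S'E gerBl mulrn_wge0.
have S'_ge0 i j : 0 <= S' i j.
  rewrite S'E; case: andP => [[/eqP-> /eqP->]|_]; last by rewrite subr0.
  by rewrite subr_ge0 ge_min lexx.
have slack'_ge0 K M : 0 <= slack S' K M.
  rewrite slack_sub_delta; case: (boolP (_ && _)) => [PKM|_]; last by rewrite subr0.
  by rewrite subr_ge0 ge_min (minIJ (K, M)) ?orbT.
have ltL : (#|L S'| < #|L S|)%N.
  apply/proper_card/properP; split.
    apply/subsetP => -[i j]; rewrite !inE /= => /andP[S'ij /'forall_forallP h].
    apply/andP; split.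
      by apply: contraNN S'ij => /eqP Sij; rewrite eq_le S'_ge0 -Sij S'_le.
    apply/'forall_forallP => K M; apply/implyP => KM.
    apply: contraTN (implyP (h K M) KM) => /eqP KM0.
    by rewrite negbK eq_le slack'_ge0 slack_sub_delta KM0 sub0r oppr_le0 mulrn_wge0.
  exists (i0, j0); rewrite !inE //=.
  apply/negP => /andP[S'ij /'forall_forallP/(_ I J)]; rewrite -/(P (I, J)) PIJ /=.
  move: S'ij; rewrite slack_sub_delta -/(P (I, J)) PIJ S'E !eqxx /= !subr_eq0.
  by rewrite /e; case: leP; rewrite eqxx.
have [B [B_ge0 rB cB B_le]] := IHk S' (leq_trans ltL leLk) S'_ge0 slack'_ge0.
by exists B; split=> // i j; apply: le_trans (B_le i j) (S'_le i j).
Qed.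

(** * Matrices of total mass n *)

(** Cross the rectangle I x J with the full one, whose slack is 0: the slacks of
    I x T and T x J, where T is everything, are minus the deficits
    of the rows in I and of the columns in J. *)
Lemma slack_ge_deficits {R : realDomainType} {n} {A : 'M[R]_n} (I J : {set 'I_n}) :
  (forall i j, 0 <= A i j) -> \sum_i \sum_j A i j = n%:R ->
  - (\sum_(i in I) (1 - \sum_j A i j) + \sum_(j in J) (1 - \sum_i A i j))
    <= slack A I J.
Proof.
move=> A_ge0 sumA; have := slack_cross I setT J setT A_ge0.
have inT (f : 'I_n -> R) : \sum_(i in setT) f i = \sum_i f i.
  by apply: eq_bigl => i; rewrite inE.
have rT : \sum_(i in I) \sum_(j in setT) A i j = \sum_(i in I) \sum_j A i j.
  by apply: eq_bigr => i _; rewrite inT.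
have cT : \sum_(i in setT) \sum_(j in J) A i j = \sum_(j in J) \sum_i A i j.
  by rewrite exchange_big; apply: eq_bigr => j _; rewrite inT.
have TT : \sum_(i in setT) \sum_(j in setT) A i j = n%:R.
  by rewrite inT -sumA; apply: eq_bigr => i _; rewrite inT.
rewrite !setIT !setUT /slack rT cT TT cardsT card_ord !sumrB !sumr_const.
by lra.
Qed.

Theorem lemma3p1 (R : realType) (n : nat) (hn : (1 <= n)%N)
    (A : 'M[R]_n) (delta t : R)
    (hA : inK A)
    (hPhi : 2 - gamma R n <= dittert A)
    (hper : permanent A = gamma R n - delta)
    (hdelta0 : 0 <= delta) (hdelta1 : delta < 1)
    (ht : t = Num.sqrt (n%:R * delta / (1 - delta)))
    (ht1 : t < 1) :
  doubly_superstochastic ((1 - t)^-1 *: A).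
Proof.
have [A_ge0 sumA] := hA.
have sumc : \sum_j csum A j = n%:R by rewrite /csum exchange_big.
have r_ge0 i : 0 <= rsum A i by rewrite sumr_ge0.
have c_ge0 j : 0 <= csum A j by rewrite sumr_ge0.
set p := \prod_i rsum A i; set q := \prod_j csum A j.
have prod_le1 (z : 'I_n -> R) : (forall i, 0 <= z i) -> \sum_i z i = n%:R ->
    \prod_i z i <= 1.
  move=> z_ge0; rewrite -[in n%:R](card_ord n) => /(prod_le_deficit set0 z_ge0).
  by rewrite big_set0 expr0n mulr0 mul0r addr0 mulr1.
have p_le1 : p <= 1 by apply: prod_le1.
have q_le1 : q <= 1 by apply: prod_le1.
have pq_ge : 1 - delta <= p * q.
  have : 0 <= (1 - p) * (1 - q) by rewrite mulr_ge0 ?subr_ge0.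
  by move: hPhi; rewrite /dittert hper -/p -/q; lra.
have n_gt0 : 0 < n%:R :> R by rewrite ltr0n.
have d_gt0 : 0 < 1 - delta by rewrite subr_gt0.
have t_gt0 : 0 < 1 - t by rewrite subr_gt0.
have deficit_le (I J : {set 'I_n}) :
    \sum_(i in I) (1 - rsum A i) + \sum_(j in J) (1 - csum A j) <= t.
  set D := _ + _.
  pose z (k : 'I_n + 'I_n) :=
    match k with inl i => rsum A i | inr j => csum A j end.
  pose K := [set k : 'I_n + 'I_n |
    match k with inl i => i \in I | inr j => j \in J end].
  have z_ge0 k : 0 <= z k by case: k.
  have sumz : \sum_k z k = #|{: 'I_n + 'I_n}|%:R.
    by rewrite big_sumType /= card_sum card_ord natrD sumc; congr (_ + _).
  have := prod_le_deficit K z_ge0 sumz.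
  have -> : \sum_(k in K) (1 - z k) = D.
    by rewrite big_sumType; congr (_ + _); apply: eq_bigl => k; rewrite inE.
  rewrite big_sumType /= -/p -/q card_sum card_ord => D_le.
  apply: le_trans (ler_norm D) _; rewrite ht -sqrtr_sqr ler_wsqrtr //.
  rewrite ler_pdivlMr //.
  have : (1 - delta) * (1 + D ^+ 2 / n%:R) <= 1.
    apply: le_trans D_le; rewrite natrD.
    have -> : 2 * D ^+ 2 / (n%:R + n%:R) = D ^+ 2 / n%:R :> R.
      by field; rewrite -natrD !pnatr_eq0 -!lt0n addn_gt0 hn.
    by rewrite ler_wpM2r // addr_ge0 // divr_ge0 ?sqr_ge0.
  have -> : (1 - delta) * (1 + D ^+ 2 / n%:R)
      = 1 - delta + (D ^+ 2 * (1 - delta)) / n%:R by field; rewrite gt_eqF.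
  rewrite -lerBrDl ler_pdivrMr //.
  by rewrite subKr (mulrC delta).
have S_ge0 i j : 0 <= ((1 - t)^-1 *: A) i j.
  by rewrite mxE mulr_ge0 // invr_ge0 ltW.
have slack_ge0 (I J : {set 'I_n}) : 0 <= slack ((1 - t)^-1 *: A) I J.
  have [IJ_le|IJ_gt] := leqP (#|I| + #|J|) n.
    rewrite /slack subr_ge0; apply: le_trans (_ : 0 <= _).
      by rewrite subr_le0 -natrD ler_nat.
    by rewrite sumr_ge0 // => i _; rewrite sumr_ge0.
  have := slack_ge_deficits I J A_ge0 sumA.
  have := deficit_le I J.
  have : n.+1%:R <= #|I|%:R + #|J|%:R :> R by rewrite -natrD ler_nat.
  rewrite /slack -/(rsum A) -natr1.
  have -> : \sum_(i in I) \sum_(j in J) ((1 - t)^-1 *: A) i j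
      = (\sum_(i in I) \sum_(j in J) A i j) / (1 - t).
    rewrite mulr_suml; apply: eq_bigr => i _; rewrite mulr_suml.
    by apply: eq_bigr => j _; rewrite mxE mulrC.
  rewrite subr_ge0 ler_pdivlMr // /rsum /csum => s_ge1 D_le slackA_ge.
  have t_ge0 : 0 <= t by rewrite ht sqrtr_ge0.
  (* As s = |I| + |J| - n is at least 1, the loss t is at most t * s. *)
  have := mulr_ge0 t_ge0 (_ : 0 <= #|I|%:R + #|J|%:R - n%:R - 1).
  by lra.
have [B [B_ge0 rB cB B_le]] := superstochastic_of_slack S_ge0 slack_ge0.
by split=> //; exists B.
Qed.
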